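(* Let $r$ be a positive integer. Every commutative non-degenerate solution $(S,s)$ on a left-zero semigroup of size $r$ with cyclic associated permutation group $\mathcal{G}(S,s)$ is completely determined, up to isomorphism, by two positive integers $m$ and $n$ such that $mn=r$, where $m$ is the number of orbits of $S$ under the action of $\mathcal{G}(S,s)$ and $n$ is the size of every orbit. That is: for every such solution all orbits have the same size $n$ and $mn=r$, and any two such solutions with the same pair $(m,n)$ are isomorphic.
   Context: A solution (set-theoretic solution of the Pentagon Equation) is a pair $(S,s)$ with $S$ a non-empty set and $s:S\times S\to S\times S$ a map such that $s_{23}s_{13}s_{12}=s_{12}s_{23}$ as maps $S^3\to S^3$, where $s_{12}=s\times \mathrm{id}$, $s_{23}=\mathrm{id}\times s$, $s_{13}=(\tau\times \mathrm{id})(\mathrm{id}\times s)(\tau\times \mathrm{id})$ and $\tau(x,y)=(y,x)$. Writing $s(x,y)=(x\cdot y,\theta_x(y))$, the pair $(S,s)$ is a solution if and only if for all $x,y,z\in S$: $(x\cdot y)\cdot z=x\cdot(y\cdot z)$, $\theta_x(y)\cdot\theta_{x\cdot y}(z)=\theta_x(y\cdot z)$, and $\theta_{\theta_x(y)}\theta_{x\cdot y}=\theta_y$; one says $(S,s)$ is a solution on the semigroup $(S,\cdot)$. It is commutative if $s_{12}s_{13}=s_{13}s_{12}$, equivalently $x\cdot y\cdot z=x\cdot z\cdot y$ and $\theta_{x\cdot y}=\theta_x$ for all $x,y,z\in S$. It is non-degenerate if every $\theta_x:S\to S$ is bijective. A semigroup is left-zero if $x\cdot y=x$ for all $x,y$.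 For a non-degenerate solution, the associated permutation group $\mathcal{G}(S,s)$ is the subgroup of $\mathrm{Sym}(S)$ generated by $\{\theta_x: x\in S\}$. Two solutions $(S,s)$, $(T,t)$ are isomorphic if there is a bijection $\phi:S\to T$ with $(\phi\times\phi)s=t(\phi\times\phi)$. *)

(* Defs.v *)
From mathcomp Require Import all_boot all_fingroup all_solvable.

Set Implicit Arguments.
Unset Strict Implicit.
Unset Printing Implicit Defensive.

Section Solutions.
Variables (S : Type) (s : S * S -> S * S).

Definition dot (x y : S) : S := (s (x, y)).1.
Definition theta (x y : S) : S := (s (x, y)).2.

(* S^3 is encoded as S * S * S = (S * S) * S. *)
Definition leg12 (p : S * S * S) : S * S * S := (s p.1, p.2).
Definition leg23 (p : S * S * S) : S * S * S :=
  let q := s (p.1.2, p.2) in (p.1.1, q.1, q.2).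
Definition flip12 (p : S * S * S) : S * S * S := (p.1.2, p.1.1, p.2).
Definition leg13 : S * S * S -> S * S * S := flip12 \o leg23 \o flip12.

Definition pentagon_solution : Prop :=
  leg23 \o leg13 \o leg12 =1 leg12 \o leg23.

Definition commutative_solution : Prop := leg12 \o leg13 =1 leg13 \o leg12.

Definition nondegenerate : Prop := forall x, bijective (theta x).

Definition on_left_zero_semigroup : Prop := forall x y, dot x y = x.

End Solutions.

Definition isomorphic_solutions (S T : Type)
    (s : S * S -> S * S) (t : T * T -> T * T) : Prop :=
  exists2 phi : S -> T, bijective phi &
    let phi2 (p : S * S) := (phi p.1, phi p.2) in phi2 \o s =1 t \o phi2.

Section PermutationGroup.
Variables (S : finType) (s : S * S -> S * S).

(* The generators are the permutations whose underlying map is some theta_x;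
   when s is nondegenerate, every theta_x arises in this way.  The product of
   {perm S} is composition in the opposite order, which affects neither the
   generated set of permutations nor its orbits and cyclicity. *)
Definition solution_perm_group : {group {perm S}} :=
  <<[set p : {perm S} | [exists x, [forall y, p y == theta s x y]]]>>%G.

Definition solution_orbits : {set {set S}} :=
  [set orbit 'P solution_perm_group x | x in [set: S]].

Definition has_orbit_type (m n : nat) : Prop :=
  #|solution_orbits| = m /\ {in solution_orbits, forall O : {set S}, #|O| = n}.

Definition cyclic_commutative_left_zero_solution : Prop :=
  [/\ pentagon_solution s, commutative_solution s, nondegenerate s,
      on_left_zero_semigroup s & cyclic solution_perm_group].

End PermutationGroup.

(* Main.v *)
Require Import Defs.
From mathcomp Require Import all_boot all_fingroup all_solvable.
From mathcomp Require Import zmodp.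

(** On a left-zero semigroup a solution is [s (x, y) = (x, theta x y)], and the
    pentagon equation says that [theta (theta x y)] after [theta x] is
    [theta y].  Writing [Theta x] for the permutation [theta x] and [G] for the
    group that these permutations generate, this extends from the generators to
    the equivariance
      [Theta (p y) = p^-1 * Theta y]  for all [p] in [G]
    ([theta_perm_act]).  Hence [p y = y] forces [p = 1]: the action is free, so
    every orbit has exactly [#|G|] points and [r] is the number of orbits times
    [#|G|].  Moreover [Theta] is injective on each orbit, so
    [x |-> (orbit of x, Theta x)] is injective, and by counting it is a
    bijection from [S] onto (orbits) x [G].  In these coordinates the solution
    becomes
      [((i, a), (j, b)) |-> ((i, a), (j, a^-1 * b))],
    which depends only on the number of orbits and on the isomorphism type of
    [G] ([isomorphic_translation_solution]).  A cyclic group is determined by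
    its order, which here is the size [n] of an orbit, so that the number and
    the common size of the orbits determine the solution. *)

Set Implicit Arguments.
Unset Strict Implicit.
Unset Printing Implicit Defensive.

Lemma isomorphic_solutions_sym (S T : Type) (s : S * S -> S * S)
    (t : T * T -> T * T) :
  isomorphic_solutions s t -> isomorphic_solutions t s.
Proof.
case=> phi [psi phiK psiK] /= phiM; exists psi; first by exists phi.
move=> /= [x y]; have /= := phiM (psi x, psi y).
by rewrite !psiK => <- /=; rewrite !phiK -surjective_pairing.
Qed.

Lemma isomorphic_solutions_trans (S T U : Type) (s : S * S -> S * S)
    (t : T * T -> T * T) (u : U * U -> U * U) :
  isomorphic_solutions s t -> isomorphic_solutions t u ->
  isomorphic_solutions s u.
Proof.
case=> phi phi_bij /= phiM [psi psi_bij /= psiM].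
exists (psi \o phi); first exact: bij_comp.
move=> /= [x y] /=; have /= <- := psiM (phi x, phi y).
by have /= <- := phiM (x, y).
Qed.

(** The normal form of the solutions under study: an index set carrying the
    orbits, and a group acting on each orbit as on itself by translations. *)
Definition translation_solution (I : Type) (gT : finGroupType)
    (p : (I * gT) * (I * gT)) : (I * gT) * (I * gT) :=
  (p.1, (p.2.1, p.1.2^-1 * p.2.2)%g).

Section LeftZeroSolution.

Local Open Scope group_scope.

Variables (S : finType) (s : S * S -> S * S).
Hypothesis pentagon_s : pentagon_solution s.
Hypothesis nondeg_s : nondegenerate s.
Hypothesis left_zero_s : on_left_zero_semigroup s.

Let G := solution_perm_group s.

Definition theta_perm (x : S) : {perm S} := perm (bij_inj (nondeg_s x)).

Lemma left_zero_solutionE (x y : S) : s (x, y) = (x, theta s x y).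
Proof. by rewrite [LHS]surjective_pairing; congr pair; apply: left_zero_s. Qed.

Lemma theta_perm_in (x : S) : theta_perm x \in G.
Proof.
by apply: mem_gen; rewrite inE; apply/existsP; exists x; apply/forallP=> y;
  rewrite permE.
Qed.

Lemma theta_theta (x y z : S) :
  theta s (theta s x y) (theta s x z) = theta s y z.
Proof.
have /(congr1 snd) := pentagon_s (x, y, z).
by rewrite /leg13 /leg12 /leg23 /flip12 /= !left_zero_solutionE.
Qed.

(** The permutations satisfying the identity form a group, and for the
    generators it is the pentagon equation. *)
Lemma theta_perm_act (p : {perm S}) (y : S) :
  p \in G -> theta_perm (p y) = p^-1 * theta_perm y.
Proof.
pose E := [set p : {perm S} |
  [forall y, theta_perm (p y) == p^-1 * theta_perm y]].
have EP (q : {perm S}) :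
    reflect (forall y, theta_perm (q y) = q^-1 * theta_perm y) (q \in E).
  by rewrite inE; apply: (iffP forallP) => Eq z; apply/eqP.
have E_group : group_set E.
  apply/group_setP; split=> [|q1 q2 /EP Eq1 /EP Eq2]; apply/EP => z.
    by rewrite perm1 invg1 mul1g.
  by rewrite permM Eq2 Eq1 invMg mulgA.
suffices /subsetP sGE : G \subset Group E_group by move=> /sGE/EP.
rewrite gen_subG; apply/subsetP=> q; rewrite inE => /existsP[x /forallP qE].
have -> : q = theta_perm x by apply/permP=> z; rewrite permE (eqP (qE z)).
apply/EP=> z; apply: (mulgI (theta_perm x)); rewrite mulKVg.
(* A product of permutations applies its left factor first. *)
by apply/permP=> u; rewrite permM !permE theta_theta.
Qed.

(** If [p] fixes [x], equivariance reads [Theta x = p^-1 * Theta x]. *)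
Lemma solution_perm_group_free (x : S) : 'C_G[x | 'P] = 1.
Proof.
apply/trivgP/subsetP=> p /setIP[Gp /astab1P /= px].
have /= := theta_perm_act x Gp; rewrite -apermE px => /(canLR (mulgK _)).
by rewrite mulgV => /eqP; rewrite eq_sym invg_eq1 inE.
Qed.

Lemma card_solution_orbit (O : {set S}) :
  O \in solution_orbits s -> #|O| = #|G|.
Proof.
by case/imsetP=> x _ ->; rewrite card_orbit solution_perm_group_free indexg1.
Qed.

Lemma card_solution_orbits : (#|solution_orbits s| * #|G|)%N = #|S|.
Proof.
have actsG : [acts G, on [set: S] | 'P].
  by apply/actsP=> p _ x; rewrite !inE.
rewrite -[RHS]cardsT; apply/esym.
by apply: card_uniform_partition (orbit_partition actsG) => O;
  apply: card_solution_orbit.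
Qed.

Lemma solution_orbit_theta (x y : S) :
  orbit 'P G (theta s x y) = orbit 'P G y.
Proof.
apply: orbit_eqP; apply/orbitP; exists (theta_perm x); first exact: theta_perm_in.
by rewrite /= apermE permE.
Qed.

(** Two points [y] and [p y] of one orbit have [theta] differing by the factor
    [p^-1], so [theta] separates the points of an orbit. *)
Lemma solution_coordinates_inj (x y : S) :
  orbit 'P G x = orbit 'P G y -> theta_perm x = theta_perm y -> x = y.
Proof.
move/orbit_eqP/orbitP=> [p Gp <-] /=; rewrite apermE theta_perm_act //.
by move/(canRL (mulgK _)); rewrite mulgV => /eqP; rewrite invg_eq1 => /eqP ->;
  rewrite perm1.
Qed.

(** The isomorphism is [x |-> (orbit of x, theta x)], read through an
    enumeration of the orbits and an isomorphism from the permutation group. *)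
Lemma isomorphic_translation_solution (m : nat) (hT : finGroupType) (x0 : S) :
    #|solution_orbits s| = m -> G \isog [set: hT] ->
  isomorphic_solutions s (@translation_solution 'I_m hT).
Proof.
move=> <- isoGH; have [f f_inj fG] := isogP isoGH.
have orbS x : orbit 'P G x \in solution_orbits s by apply/imset_f/in_setT.
pose phi x := (enum_rank_in (orbS x0) (orbit 'P G x), f (theta_perm x)).
have phi_inj : injective phi.
  move=> x y [/enum_rank_in_inj eq_orb /(injmP f_inj) eq_theta].
  by apply: solution_coordinates_inj;
    [apply: eq_orb | apply: eq_theta; apply: theta_perm_in].
exists phi.
  apply: inj_card_bij => //.
  by rewrite card_prod card_ord -cardsT -(card_isog isoGH) card_solution_orbits.
move=> /= [x y]; rewrite /= left_zero_solutionE /= /translation_solution /phi /=.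
rewrite solution_orbit_theta; congr (_, (_, _)).
have -> : theta s x y = theta_perm x y by rewrite permE.
by rewrite theta_perm_act ?theta_perm_in // morphM ?morphV ?groupV ?theta_perm_in.
Qed.

End LeftZeroSolution.

(** The group of residues ['I_n.-1.+1] serves as the standard cyclic group of
    order [n]; the successor form is what gives it a group structure, and [n] is
    positive as the size of an orbit. *)
Lemma cyclic_solution_normal_form (S : finType) (s : S * S -> S * S)
    (m n : nat) :
    0 < #|S| -> cyclic_commutative_left_zero_solution s ->
    has_orbit_type s m n ->
  isomorphic_solutions s (@translation_solution 'I_m 'I_n.-1.+1).
Proof.
case/card_gt0P=> x0 _ [pent_s _ nd_s lz_s cycG] [card_m card_n].
(* The orbit of x0 shows that n is the order of the permutation group. *)
have orb0 : orbit 'P (solution_perm_group s) x0 \in solution_orbits s.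
  exact/imset_f/in_setT.
have cardG : #|solution_perm_group s| = n.
  by rewrite -(card_solution_orbit pent_s nd_s lz_s orb0) card_n.
apply: (isomorphic_translation_solution pent_s nd_s lz_s x0 card_m).
have cycT : cyclic [set: 'I_n.-1.+1] by rewrite Zp_cycle cycle_cyclic.
by rewrite isog_cyclic_card // cycT cardsT card_ord cardG prednK //= -cardG.
Qed.

Theorem theorem26 (r : nat) (r_gt0 : 0 < r) :
  (forall (S : finType) (s : S * S -> S * S),
     #|S| = r -> cyclic_commutative_left_zero_solution s ->
     exists m n : nat,
       [/\ 0 < m, 0 < n, m * n = r & has_orbit_type s m n])
  /\
  (forall (S T : finType) (s : S * S -> S * S) (t : T * T -> T * T) (m n : nat),
     #|S| = r -> cyclic_commutative_left_zero_solution s ->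
     #|T| = r -> cyclic_commutative_left_zero_solution t ->
     has_orbit_type s m n -> has_orbit_type t m n ->
     isomorphic_solutions s t).
Proof.
split=> [S s cardS [pent_s _ nd_s lz_s _] | S T s t m n cS sol_s cT sol_t os ot].
  have cardE := card_solution_orbits pent_s nd_s lz_s.
  exists #|solution_orbits s|, #|solution_perm_group s|.
  have := r_gt0; rewrite -cardS -cardE muln_gt0 => /andP[m_gt0 n_gt0].
  split=> //; split=> // O; exact: (card_solution_orbit pent_s nd_s lz_s).
apply: isomorphic_solutions_trans (isomorphic_solutions_sym _).
  by apply: cyclic_solution_normal_form os; rewrite ?cS.
by apply: cyclic_solution_normal_form ot; rewrite ?cT.
Qed.
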